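(* Let $g \colon \mathrm{Comp}_{>0} \to \mathbbm{k}$ be the map such that $M_\alpha = \sum_{\beta \ge \alpha} g(\alpha, \beta) X_\beta$, where $X_\alpha = \sum_{\beta \ge \alpha} f(\alpha, \beta) M_\beta$ with \[ f(\alpha) = \begin{cases} f_\mathbb{E}(\alpha|_\mathbb{E}) \frac{1}{\mathrm{odd}(\alpha)!} & \text{if } \alpha = \alpha|_\mathbb{E} \, \alpha|_\mathbb{O}, \\ 0 & \text{otherwise.} \end{cases} \] For $|\alpha|$ odd, \[ g(\alpha) = \begin{cases} \displaystyle\frac{(-1)^{\ell(\alpha)-1}}{\mathrm{odd}(\alpha)} & \text{if the last part of } \alpha \text{ is odd}, \\ 0 & \text{otherwise.} \end{cases} \]
   Context: Work over a field $\mathbbm{k}$ of characteristic zero. Compositions are finite sequences of positive integers; $\mathrm{Comp}_{>0}$ denotes nonempty ones; $\mathrm{odd}(\alpha)$ is the number of odd parts of $\alpha$; $|\alpha|$ its sum and $\ell(\alpha)$ its length. $\mathbb{E}=\{2,4,6,\dots\}$, $\mathbb{O}=\{1,3,5,\dots\}$, and $\alpha|_C$ is the subsequence of parts of $\alpha$ in $C$. For $\alpha\le\beta$ (i.e. $\alpha=\alpha^{(1)}\cdots\alpha^{(\ell(\beta))}$ with $\alpha^{(i)}$ a composition of $\beta_i$) and a function $h$ on $\mathrm{Comp}_{>0}$, $h(\alpha,\beta)=\prod_i h(\alpha^{(i)})$. $\{M_\alpha\}$ is the monomial basis of $\mathrm{QSym}$. $f_\mathbb{E}$ is any nonsingular shuffle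 character: $f_\mathbb{E}(n)\ne0$ for all $n$ and, with $f_\mathbb{E}(\emptyset)=1$, $f_\mathbb{E}(\alpha)f_\mathbb{E}(\beta)=\sum_{\gamma\in\alpha \sqcup\!\sqcup \beta}f_\mathbb{E}(\gamma)$, where $\alpha \sqcup\!\sqcup \beta$ is the multiset of compositions of length $\ell(\alpha)+\ell(\beta)$ containing $\alpha,\beta$ as disjoint subsequences, with multiplicity. *)

(* Defs.v *)
From HB Require Import structures.
From mathcomp Require Import all_boot all_order all_algebra finmap.
Set Implicit Arguments.
Unset Strict Implicit.
Unset Printing Implicit Defensive.
Import Order.TTheory GRing.Theory Num.Theory.

Local Open Scope nat_scope.

(* Compositions are sequences of naturals satisfying [is_comp]. Functions on
   compositions are total on [seq nat]; their values elsewhere never matter. *)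
Definition is_comp (a : seq nat) : bool := all (fun n => 0 < n) a.

Fixpoint compositions (n : nat) : seq (seq nat) :=
  if n is m.+1 then
    [seq 1 :: b | b <- compositions m] ++
    [seq (head 0 b).+1 :: behead b | b <- compositions m & b != [::]]
  else [:: [::]].

(* The least k such that the first k parts of a sum to at least n
   (size a if there is none). *)
Fixpoint nparts (n : nat) (a : seq nat) : nat :=
  if a is x :: a' then (if n == 0 then 0 else (nparts (n - x) a').+1) else 0.

(* When a <= b, the sequence of blocks a^(1), ..., a^(l(b)); see blocksK. *)
Fixpoint blocks (a b : seq nat) : seq (seq nat) :=
  if b is n :: b' then
    let k := nparts n a in take k a :: blocks (drop k a) b'
  else [::].

(* The order a <= b of refinement; see refinesP. *)
Definition refines (a b : seq nat) : bool :=
  (flatten (blocks a b) == a) && (map sumn (blocks a b) == b).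

(* Each interleaving is listed once, hence with multiplicity;
   see count_shuffle. *)
Fixpoint shuffle (a : seq nat) : seq nat -> seq (seq nat) :=
  if a is x :: a' then
    fix shuffle_a b :=
      if b is y :: b' then
        [seq x :: c | c <- shuffle a' b] ++ [seq y :: c | c <- shuffle_a b']
      else [:: a]
  else fun b => [:: b].

Definition evens (a : seq nat) : seq nat := [seq n <- a | ~~ odd n].
Definition odds (a : seq nat) : seq nat := [seq n <- a | odd n].
Definition nodd (a : seq nat) : nat := count odd a.

Lemma mem_compositions n a :
  (a \in compositions n) = is_comp a && (sumn a == n).
Proof.
elim: n a => [|n IHn] [|x a] /=.
- by [].
- by rewrite inE; case: x => [|x] //=; rewrite andbF.
- rewrite mem_cat; apply/negP => /orP[] /mapP[b _] //.
rewrite mem_cat; case: x => [|x] /=.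
  by apply/negP => /orP[] /mapP[b _] [].
rewrite addSn eqSS; apply/orP/idP => [[]|/andP[pa sa]].
- by case/mapP => b; rewrite IHn => /andP[pb sb] [-> ->]; rewrite -/(is_comp b) pb add0n sb.
- case/mapP => -[|y b]; rewrite mem_filter //= IHn /= => /andP[/andP[_ pb] sb].
  by move=> [-> ->]; rewrite -/(is_comp b) pb sb.
case: x sa => [|x] sa.
  by left; apply/mapP; exists a => //; rewrite IHn pa.
right; apply/mapP; exists (x.+1 :: a) => //.
by rewrite mem_filter /= IHn /= pa sa.
Qed.

Lemma compositions_uniq n : uniq (compositions n).
Proof.
elim: n => //= n IHn; rewrite cat_uniq; apply/and3P; split.
- by rewrite map_inj_uniq // => a b [].
- apply/hasPn => c0 /mapP[b]; rewrite mem_filter mem_compositions.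
  case: b => [|y b] //= /andP[/andP[y0 _] _] ->.
  by apply/negP => /mapP[c _] [yE _]; rewrite yE in y0.
rewrite map_inj_in_uniq ?filter_uniq // => -[|x a] [|y b];
  rewrite ?mem_filter //=.
by move=> _ _ [-> ->].
Qed.

Lemma nparts_cat (c a : seq nat) : is_comp c -> nparts (sumn c) (c ++ a) = size c.
Proof.
elim: c => [|x c IHc] /=; first by case: a.
by case/andP=> x0 pc; rewrite addn_eq0 eqn0Ngt x0 /= addKn IHc.
Qed.

Lemma blocksK (bs : seq (seq nat)) :
  is_comp (flatten bs) -> blocks (flatten bs) (map sumn bs) = bs.
Proof.
elim: bs => //= c bs IHbs; rewrite /is_comp all_cat => /andP[pc pbs].
by rewrite nparts_cat // take_size_cat // drop_size_cat // IHbs.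
Qed.

Lemma refinesP (a b : seq nat) : is_comp a ->
  reflect (exists2 bs, flatten bs = a & map sumn bs = b) (refines a b).
Proof.
move=> pa; apply: (iffP andP) => [[/eqP Ha /eqP Hb]|[bs Ha Hb]].
  by exists (blocks a b).
by rewrite -Hb -Ha blocksK ?Ha // !eqxx.
Qed.

Lemma card_bool_tupleS n (P : pred (seq bool)) :
  #|[set m : n.+1.-tuple bool | P m]| =
  #|[set m : n.-tuple bool | P (true :: m)]| +
  #|[set m : n.-tuple bool | P (false :: m)]|.
Proof.
rewrite -!sum1dep_card.
pose h (p : bool * n.-tuple bool) : n.+1.-tuple bool := cons_tuple p.1 p.2.
rewrite (reindex h) /=; last first.
  exists (fun t : n.+1.-tuple bool => (thead t, behead_tuple t)).
    by case=> x t _; congr pair; apply: val_inj.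
  by move=> t _; apply: val_inj; rewrite /= [in RHS](tuple_eta t).
rewrite big_mkcond -(pair_big xpredT xpredT
  (fun x (t : n.-tuple bool) => if P (x :: t) then 1 else 0)) /=.
by rewrite big_bool -!big_mkcond.
Qed.

Lemma count_shuffle (a b c : seq nat) :
  count_mem c (shuffle a b) =
  #|[set m : (size c).-tuple bool |
      (mask m c == a) && (mask (map negb m) c == b)]|.
Proof.
have count_cons x z (d : seq nat) s :
    count_mem (z :: d) [seq x :: e | e <- s] = (x == z) * count_mem d s.
  rewrite count_map; case: (eqVneq x z) => [->|xz].
    by rewrite mul1n; apply: eq_count => e /=; rewrite eqseq_cons eqxx.
  by rewrite mul0n -(count_pred0 s); apply: eq_count => e /=;
    rewrite eqseq_cons (negbTE xz).
have shuf0 d : shuffle d [::] = [:: d] by case: d.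
elim: c a b => [|z c IHc] a b.
  rewrite (eq_card (B := [pred m : 0.-tuple bool | (a == [::]) && (b == [::])]));
    last by move=> m; rewrite !inE !mask0 [a == _]eq_sym [b == _]eq_sym.
  case: a b => [|x a] [|y b] /=; rewrite ?(eq_card0 (A := [pred _ | false])) //.
  - by rewrite (eq_card (B := predT)) // card_tuple expn0.
  - rewrite count_cat !count_map !(eq_count (a2 := pred0)) ?count_pred0 //.
rewrite (card_bool_tupleS _
  (fun m => (mask m (z :: c) == a) && (mask (map negb m) (z :: c) == b))) /=.
have cardE (Q : pred (seq bool)) (e : bool) (N : nat) :
    #|[set m : (size c).-tuple bool | Q m]| = N ->
    #|[set m : (size c).-tuple bool | e && Q m]| = e * N.
  case: e => [<-|_]; first by rewrite mul1n.
  by rewrite mul0n; apply: eq_card0 => m; rewrite !inE.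
have -> : #|[set m : (size c).-tuple bool |
    (z :: mask m c == a) && (mask (map negb m) c == b)]| =
    if a is x :: a' then (x == z) * count_mem c (shuffle a' b) else 0.
  case: a => [|x a].
    by apply: eq_card0 => m; rewrite !inE.
  apply: etrans (cardE (fun m => (mask m c == a) && (mask (map negb m) c == b))
    _ _ (esym (IHc a b))).
  by apply: eq_card => m; rewrite !inE eqseq_cons [z == x]eq_sym andbA.
have -> : #|[set m : (size c).-tuple bool |
    (mask m c == a) && (z :: mask (map negb m) c == b)]| =
    if b is y :: b' then (y == z) * count_mem c (shuffle a b') else 0.
  case: b => [|y b].
    by apply: eq_card0 => m; rewrite !inE andbF.
  apply: etrans (cardE (fun m => (mask m c == a) && (mask (map negb m) c == b))
    _ _ (esym (IHc a b))).
  by apply: eq_card => m; rewrite !inE eqseq_cons [z == y]eq_sym andbCA.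
case: a b => [|x a] [|y b].
- by [].
- by rewrite /= !addn0 add0n eqseq_cons mulnb.
- by rewrite shuf0 /= shuf0 /= !addn0 eqseq_cons mulnb.
- by rewrite [shuffle (x :: a) (y :: b)]/= count_cat !count_cons.
Qed.

Local Open Scope ring_scope.

(* Exponent vectors of the monomials in the variables x_0, x_1, x_2, ... *)
Definition exponents := {fsfun nat -> nat with 0%N}.

(* Formal power series, as families of coefficients. *)
Definition pseries (k : fieldType) := exponents -> k.

(* M_a = \sum_(i_1 < ... < i_l) x_{i_1}^{a_1} ... x_{i_l}^{a_l} : the monomials
   whose nonzero exponents, in increasing order of the variables, form a. *)
Definition monomial_qsym (k : fieldType) (a : seq nat) : pseries k :=
  fun e => ([seq e i | i <- sort leq (finsupp e)] == a)%:R.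

(* h(a, b) for a <= b *)
Definition block_prod (k : fieldType) (h : seq nat -> k) (a b : seq nat) : k :=
  \prod_(c <- blocks a b) h c.

(* \sum_(b >= a) h(a, b) F_b ; every b >= a is a composition of |a|. *)
Definition coarser_sum (k : fieldType) (h : seq nat -> k)
    (F : seq nat -> pseries k) (a : seq nat) : pseries k :=
  fun e => \sum_(b <- compositions (sumn a) | refines a b)
             block_prod h a b * F b e.

Definition even_comp (a : seq nat) : bool :=
  is_comp a && all (fun n => ~~ odd n) a.

Record nonsingular_shuffle_character (k : fieldType) (fE : seq nat -> k)
    : Prop := NonsingularShuffleCharacter {
  shuffle_char_nil : fE [::] = 1;
  shuffle_charM : forall a b : seq nat, even_comp a -> even_comp b ->
    fE a * fE b = \sum_(c <- shuffle a b) fE c;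
  shuffle_char_neq0 : forall n : nat, (0 < n)%N -> ~~ odd n -> fE [:: n] != 0
}.

Definition even_odd_fun (k : fieldType) (fE : seq nat -> k) (a : seq nat) : k :=
  if a == evens a ++ odds a then fE (evens a) * ((nodd a)`!%:R)^-1 else 0.

Definition even_odd_basis (k : fieldType) (fE : seq nat -> k) (a : seq nat)
    : pseries k :=
  coarser_sum (even_odd_fun fE) (monomial_qsym k) a.

(* Main.v *)
Require Import Defs.
From HB Require Import structures.
From mathcomp Require Import all_boot all_order all_algebra finmap.
From mathcomp Require Import ring zify.
Import Order.TTheory GRing.Theory Num.Theory.
Set Implicit Arguments.
Unset Strict Implicit.
Unset Printing Implicit Defensive.
Local Open Scope ring_scope.

(* View functions on compositions as noncommutative power series in letters
   x_1, x_2, ..., multiplied by convolution over deconcatenations. Comparing the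
   coefficients of M_(|w|) in M_w = \sum g(w, b) X_b gives E * exp(G) = 1 + P,
   where G is the part of g of odd total degree, E is built from the even part
   of g and fE, and P = \sum_n x_n = Pe + Po. Since E is even, the parity of the
   total degree separates this into E * cosh(G) = 1 + Pe and
   E * sinh(G) = Po, so E drops out and tanh(G) = Q := (1 + Pe)^-1 * Po. Hence
   G = artanh(Q) = \sum_(m odd) Q^m / m, and Q^m is supported on the words with
   m odd letters, the last letter being odd, with coefficients +-1.
   For a fixed word a, the series are represented by the triangular matrices of
   their coefficients at the factors of a, where G and Q are nilpotent. *)

(** * Deconcatenations and coarsenings *)

Fixpoint cuts (T : Type) (w : seq T) : seq (seq T * seq T) :=
  ([::], w) ::
    if w is x :: w' then [seq (x :: p.1, p.2) | p <- cuts w'] else [::].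

Lemma mem_cuts (T : eqType) (w : seq T) p :
  (p \in cuts w) = (p.1 ++ p.2 == w).
Proof.
elim: w p => [|x w IHw] [u v] /=; rewrite inE xpair_eqE.
  by case: u => //=; rewrite orbF.
case: u => [|y u] /=.
  by rewrite orbC; case: mapP => //= -[q _].
rewrite eqseq_cons; apply/mapP/andP => /=.
  by case=> q; rewrite IHw => /eqP qw [-> -> ->]; rewrite qw.
by case=> /eqP-> uv; exists (u, v); rewrite ?IHw.
Qed.

Lemma cuts_uniq (T : eqType) (w : seq T) : uniq (cuts w).
Proof.
elim: w => //= x w IHw; rewrite map_inj_uniq ?IHw ?andbT.
  by apply/mapP => -[].
by move=> [? ?] [? ?] [-> ->].
Qed.

Lemma cutsE (T : Type) (w : seq T) :
  cuts w = [seq (take i w, drop i w) | i <- iota 0 (size w).+1].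
Proof.
elim: w => // x w IHw; rewrite [LHS]/= IHw.
rewrite -[iota _ (size (x :: w)).+1]/(0%N :: iota (1 + 0) (size w).+1).
by rewrite map_cons iotaDl -!map_comp.
Qed.

(** The letter type is arbitrary because this product serves both words of parts and sequences of
    blocks. *)
Definition conv (k : fieldType) (T : Type) (u v : seq T -> k) (w : seq T) : k :=
  \sum_(p <- cuts w) u p.1 * v p.2.

Lemma conv_nil (k : fieldType) (T : Type) (u v : seq T -> k) :
  conv u v [::] = u [::] * v [::].
Proof. by rewrite /conv big_seq1. Qed.

Lemma conv_cons (k : fieldType) (T : Type) (u v : seq T -> k) x w :
  conv u v (x :: w) = u [::] * v (x :: w) + conv (fun w => u (x :: w)) v w.
Proof. by rewrite /conv big_cons big_map. Qed.

Lemma eq_conv (k : fieldType) (T : Type) (u u' v : seq T -> k) :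
  u =1 u' -> conv u v =1 conv u' v.
Proof. by move=> uu' w; apply: eq_bigr => p _; rewrite uu'. Qed.

Lemma convZl (k : fieldType) (T : Type) c (u v : seq T -> k) w :
  conv (fun w => c * u w) v w = c * conv u v w.
Proof. by rewrite [RHS]big_distrr; apply: eq_bigr => p _; rewrite /= mulrA. Qed.

Lemma conv_scalarl (k : fieldType) (T : Type) (u v : seq T -> k) w :
  (forall x w, u (x :: w) = 0) -> conv u v w = u [::] * v w.
Proof.
move=> u0; case: w => [|x w]; first exact: conv_nil.
by rewrite conv_cons [X in _ + X]big1 ?addr0 // => p _; rewrite u0 mul0r.
Qed.

Definition splits (w : seq nat) : seq (seq (seq nat)) :=
  [seq blocks w b | b <- compositions (sumn w) & refines w b].

(** A block of positive parts has sum zero only when it is empty, so coarsenings of [w] amount to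
    its factorizations into nonempty words. This removes [blocks] and [refines] from later
    arguments. *)
Lemma mem_splits w bs :
  is_comp w -> (bs \in splits w) = (flatten bs == w) && ([::] \notin bs).
Proof.
move=> pw; apply/mapP/andP => [[b + ->]|[/eqP bsw bs0]].
  rewrite mem_filter mem_compositions => /andP[/andP[-> /eqP bE] /andP[pb _]].
  split=> //; apply: contraL pb => /(map_f sumn); rewrite bE => b0.
  by apply/allPn; exists 0%N.
have bsK : blocks w (map sumn bs) = bs by rewrite -bsw blocksK ?bsw.
exists (map sumn bs); rewrite ?bsK // mem_filter mem_compositions.
rewrite -[in sumn w]bsw sumn_flatten eqxx andbT; apply/andP; split.
  by apply/refinesP => //; exists bs.
apply/allP => _ /mapP[c cbs ->]; move: pw; rewrite -bsw.
rewrite lt0n; apply: contraTneq => c0; apply/allPn.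
case: c cbs c0 => [|x c] cbs /=; first by rewrite cbs in bs0.
move/eqP; rewrite addn_eq0 => /andP[/eqP x0 _]; exists x; rewrite ?x0 //.
by apply/flattenP; exists (x :: c); rewrite // x0 mem_head.
Qed.

Lemma splits_uniq w : uniq (splits w).
Proof.
rewrite map_inj_in_uniq ?filter_uniq ?compositions_uniq // => b c.
rewrite !mem_filter => /andP[/andP[_ /eqP bE] _] /andP[/andP[_ /eqP cE] _] bc.
by rewrite -bE bc.
Qed.

Definition split_sum (k : fieldType) (u : seq (seq nat) -> k) (w : seq nat) :
    k :=
  \sum_(bs <- splits w) u bs.

(** Cutting [w] and then splitting both pieces yields the same pairs as splitting [w] and then
    cutting between blocks. This is why substituting series for letters is multiplicative. *)
Lemma conv_split_sum (k : fieldType) (u v : seq (seq nat) -> k) w :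
  is_comp w ->
  conv (split_sum u) (split_sum v) w = split_sum (conv u v) w.
Proof.
move=> pw; rewrite /split_sum /conv.
pose pairs (p : seq nat * seq nat) :=
  [seq (x, y) | x <- splits p.1, y <- splits p.2].
transitivity (\sum_(q <- [seq q | p <- cuts w, q <- pairs p]) u q.1 * v q.2).
  rewrite big_allpairs_dep; apply: eq_bigr => p _.
  rewrite big_allpairs_dep big_distrl; apply: eq_bigr => x _.
  by rewrite big_distrr.
transitivity (\sum_(q <- [seq q | bs <- splits w, q <- cuts bs]) u q.1 * v q.2);
  last by rewrite big_allpairs_dep.
have comp_cut p : p \in cuts w -> is_comp p.1 /\ is_comp p.2.
  rewrite mem_cuts => /eqP pE.
  by move: pw; rewrite -pE /is_comp all_cat => /andP.
have pairsP p q : p \in cuts w -> (q \in pairs p) =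
    [&& flatten q.1 == p.1, flatten q.2 == p.2 & [::] \notin q.1 ++ q.2].
  move=> /comp_cut[p1 p2]; rewrite mem_cat negb_or; case: q => x y /=.
  apply/allpairsP/idP => [[[x' y'] /= [+ + [-> ->]]]|].
    by rewrite !mem_splits // => /andP[-> ->] /andP[-> ->].
  case/and4P=> *; exists (x, y); rewrite !mem_splits //=.
  by split=> //; apply/andP.
(* Both lists enumerate, without repetition, the pairs of sequences of nonempty blocks whose
   concatenation flattens to [w]. *)
apply: perm_big; apply: uniq_perm.
- apply: allpairs_uniq_dep => [|p _|]; first exact: cuts_uniq.
    by apply: allpairs_uniq; rewrite ?splits_uniq // => -[? ?] [? ?].
  move=> _ _ /allpairsPdep[p [q [pw1 + ->]]] /allpairsPdep[p' [q' [pw2 + ->]]] /=.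
  rewrite !pairsP // => /and3P[/eqP e1 /eqP e2 _] /and3P[/eqP e3 /eqP e4 _] eq.
  move: e1 e2; rewrite eq e3 e4; case: p {pw1} => p1 p2 /= <- <-.
  by case: p' {pw2 e3 e4}.
- apply: allpairs_uniq_dep => [|bs _|]; rewrite ?splits_uniq ?cuts_uniq //.
  move=> _ _ /allpairsPdep[p [q [_ + ->]]] /allpairsPdep[p' [q' [_ + ->]]] /=.
  by rewrite !mem_cuts => /eqP<- /eqP<- ->.
move=> q; apply/allpairsPdep/allpairsPdep => -[p [q' [pw1 + qE]]]; rewrite -{q'}qE.
  rewrite pairsP // => /and3P[/eqP q1 /eqP q2 q0].
  exists (q.1 ++ q.2), q; split; rewrite ?mem_cuts ?mem_splits //.
  by rewrite q0 andbT flatten_cat q1 q2 -mem_cuts.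
rewrite mem_cuts => /eqP qp; exists (flatten q.1, flatten q.2), q.
have fw : (flatten q.1, flatten q.2) \in cuts w.
  rewrite mem_cuts /= -flatten_cat qp.
  by move: pw1; rewrite mem_splits // => /andP[].
split=> //; rewrite pairsP //= !eqxx /= qp.
by move: pw1; rewrite mem_splits // => /andP[].
Qed.

(** * tanh (artanh X) = X *)

Lemma sinh_cosh_artanh (k : fieldType) (h : nat)
    (A : {poly k} := \sum_(j < h) (j.*2.+1)%:R^-1 *: 'X^(j.*2.+1)) :
  [pchar k] =i pred0 ->
  exists r, \sum_(j < h) ((j.*2.+1)`!%:R)^-1 *: A ^+ j.*2.+1
    = (\sum_(j < h) ((j.*2)`!%:R)^-1 *: A ^+ j.*2) * 'X + r * 'X^(h.*2).
(* Write S and C for the two sums, sinh(A) and cosh(A) with A = artanh(X), and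
   d = S - C X: modulo X^(2h-1), (1 - X^2) A' = 1 gives (1 - X^2) d' = - X d,
   which forces the coefficients of d to vanish one after the other. *)
Proof.
move/pcharf0P => char0.
have nat0 n : n.+1%:R != 0 :> k by rewrite char0.
have fact0 n : n`!%:R != 0 :> k by rewrite char0 -lt0n fact_gt0.
case: h @A => [|h] A.
  by exists 0; rewrite !big_ord0 !mul0r addr0.
set S := \sum_(j < _) _ *: A ^+ _; set C := \sum_(j < _) _ *: A ^+ _.
have A' : (1 - 'X^2) * A^`() = 1 - 'X^(h.+1.*2).
  have -> : A^`() = \sum_(j < h.+1) ('X^2) ^+ j.
    rewrite raddf_sum; apply: eq_bigr => j _ /=.
    by rewrite derivZ derivXn -scaler_nat scalerA mulVf // scale1r -exprM mul2n.
  by rewrite -opprB mulNr -subrX1 opprB -exprM mul2n.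
have S' : S^`() = A^`() * C.
  rewrite raddf_sum mulr_sumr; apply: eq_bigr => j _ /=.
  rewrite derivZ deriv_exp -scaler_nat scalerA -scalerAr factS natrM invfM.
  by rewrite mulrAC mulVf // mul1r.
pose c : k := (h.*2.+1`!%:R)^-1.
(* [C] stops one degree below [S], so its derivative misses the last term of [S]. *)
have C' : C^`() = A^`() * (S - c *: A ^+ h.*2.+1).
  rewrite /S big_ord_recr addrK /C big_ord_recl expr0 raddfD raddf_sum /=.
  rewrite derivZ derivC scaler0 add0r mulr_sumr; apply: eq_bigr => j _ /=.
  rewrite -[bump 0 j]/(j.+1) doubleS derivZ deriv_exp -scaler_nat scalerA.
  rewrite -scalerAr factS natrM invfM.
  by rewrite mulrAC mulVf // mul1r.
(* [A] has no constant term, so the correction in [C'] is divisible by ['X^(h.*2.+1)] and goes into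
   the remainder [r]. *)
have [B AE] : exists B, A = 'X * B.
  exists (\sum_(j < h.+1) j.*2.+1%:R^-1 *: 'X^(j.*2)).
  by rewrite mulr_sumr; apply: eq_bigr => j _; rewrite exprS scalerAr.
pose d := S - C * 'X.
pose r := 'X * (c *: B ^+ h.*2.+1) - 'X * (C - (S - c *: A ^+ h.*2.+1) * 'X).
have d' : (1 - 'X^2) * d^`() = - ('X * d) + 'X^(h.*2.+1) * r.
  transitivity ((1 - 'X^2) * A^`() * (C - (S - c *: A ^+ h.*2.+1) * 'X)
      - (1 - 'X^2) * C).
    by rewrite /d derivB derivM S' C' derivX; ring.
  rewrite A' /r /d AE exprMn doubleS 2!exprS -!mul_polyC.
  move: 'X^(h.*2) (B ^+ _) => X Y.
  ring.
(* In degree [n < h.*2.+1] the equation expresses [(n + 1) d_(n+1)] through [d_(n-1)], and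
   characteristic zero allows division by [n + 1]. *)
have d0 n : (n < h.+1.*2)%N -> d`_n = 0.
  elim/ltn_ind: n => -[|n] IHn nh.
    rewrite -horner_coef0 /d /S AE hornerD hornerN hornerM hornerX mulr0 subr0.
    rewrite horner_sum big1 // => j _.
    by rewrite hornerZ horner_exp hornerM hornerX mul0r expr0n mulr0.
  have nh' : (n < h.*2.+1)%N by move: nh; rewrite doubleS ltnS.
  have := congr1 (fun p : {poly k} => p`_n) d'.
  rewrite coefD coefN coefXnM coefXM nh' addr0.
  rewrite mulrBl mul1r coefB coefXnM !coef_deriv.
  suff [-> ->] : (if (n < 2)%N then 0 else d`_(n - 2).+1 *+ (n - 2).+1) = 0 /\
      (if n == 0%N then 0 else d`_n.-1) = 0.
    rewrite subr0 oppr0 -mulr_natr => /eqP.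
    by rewrite mulf_eq0 (negbTE (nat0 n)) orbF => /eqP.
  case: n IHn nh {nh'} => [|[|n]] IHn nh //=; first by rewrite IHn.
  have n1 : (n.+1 < h.+1.*2)%N by apply: leq_trans nh; rewrite ltnS ltnW.
  by rewrite !subSS subn0 !IHn ?mul0rn.
exists (drop_poly h.+1.*2 d).
rewrite addrC; apply/eqP; rewrite -subr_eq -/d; apply/eqP.
rewrite -[LHS](poly_take_drop h.+1.*2) [take_poly _ _](_ : _ = 0) ?add0r //.
by apply/polyP => i; rewrite coef_take_poly coef0; case: ifP => // /d0.
Qed.

(** * Hyperbolic functions of strictly upper triangular matrices *)

(** The filtration by superdiagonals stands in for the order of a power series: orders add under
    products, and order at least the matrix size means zero. *)
Definition upper (R : pzRingType) (n d : nat) (A : 'M[R]_n) : Prop :=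
  forall i j : 'I_n, (j < i + d)%N -> A i j = 0.

Lemma upper_leq (R : pzRingType) n d e (A : 'M[R]_n) :
  (d <= e)%N -> upper e A -> upper d A.
Proof. by move=> de Ae i j ij; apply: Ae; lia. Qed.

Lemma upper0 (R : pzRingType) n d : upper d (0 : 'M[R]_n).
Proof. by move=> i j _; rewrite mxE. Qed.

Lemma upperD (R : pzRingType) n d (A B : 'M[R]_n) :
  upper d A -> upper d B -> upper d (A + B).
Proof. by move=> Ad Bd i j ij; rewrite mxE Ad ?Bd ?addr0. Qed.

Lemma upperN (R : pzRingType) n d (A : 'M[R]_n) : upper d A -> upper d (- A).
Proof. by move=> Ad i j ij; rewrite mxE Ad ?oppr0. Qed.

Lemma upperZ (R : pzRingType) n d c (A : 'M[R]_n) :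
  upper d A -> upper d (c *: A).
Proof. by move=> Ad i j ij; rewrite mxE Ad ?mulr0. Qed.

Lemma upper_sum (R : pzRingType) n d (I : finType) (F : I -> 'M[R]_n) :
  (forall i, upper d (F i)) -> upper d (\sum_i F i).
Proof.
by move=> Fd; elim/big_ind: _ => // [|A B]; [apply: upper0 | apply: upperD].
Qed.

Lemma upperM (R : pzRingType) n d e (A B : 'M[R]_n) :
  upper d A -> upper e B -> upper (d + e) (A *m B).
Proof.
move=> Ad Be i j ij; rewrite mxE big1 // => h _.
have [hi|hi] := ltnP h (i + d)%N; first by rewrite Ad ?mul0r.
by rewrite Be ?mulr0 //; lia.
Qed.

Lemma upper1X (R : pzRingType) n m (A : 'M[R]_n.+1) :
  upper 1 A -> upper m (A ^+ m).
Proof.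
move=> A1; elim: m => [|m IHm]; last by rewrite exprS -[m.+1]add1n; apply: upperM.
by move=> i j; rewrite addn0 mxE => ij; rewrite -val_eqE gtn_eqF.
Qed.

Lemma upper_eq0 (R : pzRingType) n d (A : 'M[R]_n) :
  (n <= d)%N -> upper d A -> A = 0.
Proof.
by move=> nd Ad; apply/matrixP => i j; rewrite mxE Ad //; have := ltn_ord j; lia.
Qed.

(** The difference of powers telescopes into products of [A - B] with [m] factors [A] or [B], each
    raising the order by one. *)
Lemma upper_subrX (R : pzRingType) n d m (A B : 'M[R]_n.+1) :
  upper 1 A -> upper 1 B -> upper d (A - B) ->
  upper (d + m) (A ^+ m.+1 - B ^+ m.+1).
Proof.
move=> A1 B1 ABd; elim: m => [|m IHm]; first by rewrite addn0.
have -> : A ^+ m.+2 - B ^+ m.+2 =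
    A ^+ m.+1 * (A - B) + (A ^+ m.+1 - B ^+ m.+1) * B.
  by rewrite mulrBr mulrBl -!exprSr addrA subrK.
apply: upperD; first by rewrite addnC; apply: upperM => //; apply: upper1X.
by rewrite addnS -[(d + m).+1]addn1; apply: upperM.
Qed.

(** Iterating [X = (1 - E) X] multiplies [X] by ever higher powers of a nilpotent matrix. *)
Lemma unitriangular_lreg (R : pzRingType) n (E X : 'M[R]_n.+1) :
  upper 1 (E - 1) -> E * X = 0 -> X = 0.
Proof.
move=> E1 EX; have XE : X = - (E - 1) * X.
  by rewrite opprB mulrBl mul1r EX subr0.
suff XN m : X = (- (E - 1)) ^+ m * X.
  by rewrite (XN n.+1) (upper_eq0 (leqnn _) (upper1X (upperN E1))) mul0r.
by elim: m => [|m IHm]; rewrite ?mul1r // exprSr -mulrA -XE.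
Qed.

(** These truncations are exact on [upper 1] matrices as soon as [n < h.*2], since the omitted
    powers vanish. *)
Definition msinh (k : fieldType) n h (A : 'M[k]_n.+1) : 'M[k]_n.+1 :=
  \sum_(j < h) ((j.*2.+1)`!%:R)^-1 *: A ^+ j.*2.+1.
Definition mcosh (k : fieldType) n h (A : 'M[k]_n.+1) : 'M[k]_n.+1 :=
  \sum_(j < h) ((j.*2)`!%:R)^-1 *: A ^+ j.*2.
Definition martanh (k : fieldType) n h (A : 'M[k]_n.+1) : 'M[k]_n.+1 :=
  \sum_(j < h) (j.*2.+1%:R)^-1 *: A ^+ j.*2.+1.

(** The order of [A - B] can be raised by one indefinitely, so [A - B] vanishes. *)
Lemma upper1_tanh_inj (k : fieldType) n h (A B Q : 'M[k]_n.+1) :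
  upper 1 A -> upper 1 B -> upper 1 Q ->
  msinh h.+1 A = mcosh h.+1 A * Q -> msinh h.+1 B = mcosh h.+1 B * Q -> A = B.
Proof.
move=> A1 B1 Q1 AQ BQ; apply/eqP; rewrite -subr_eq0; apply/eqP.
suff ABd d : upper d.+1 (A - B) by apply: (upper_eq0 (leqnSn _)).
elim: d => [|d IHd]; first by apply: upperD => //; apply: upperN.
(* The linear terms of sinh are isolated. The constant terms of cosh cancel, so every term on the
   right has higher order than [A - B] is known to have. *)
have -> : A - B = (mcosh h.+1 A - mcosh h.+1 B) * Q
    - \sum_(j < h) ((j.+1.*2.+1)`!%:R)^-1 *: (A ^+ j.+1.*2.+1 - B ^+ j.+1.*2.+1).
  rewrite mulrBl -AQ -BQ /msinh !big_ord_recl /= !invr1 !scale1r !expr1.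
  rewrite (eq_bigr _ (fun j _ => scalerBr _ _ _)).
  rewrite sumrB.
  pose F X := \sum_(j < h) ((j.+1.*2.+1)`!%:R)^-1 *: X ^+ j.+1.*2.+1 : 'M[k]_n.+1.
  rewrite -[RHS]/(A + F A - (B + F B) - (F A - F B)).
  by rewrite opprD addrACA addrK.
apply: upperD.
  rewrite -[d.+2]addn1; apply: upperM => //; rewrite /mcosh -sumrB.
  apply: upper_sum => j; rewrite -scalerBr; apply: upperZ.
  case: j => -[|j] jh /=; first by rewrite subrr; apply: upper0.
  by apply: upper_leq (upper_subrX A1 B1 IHd); lia.
apply/upperN/upper_sum => j; apply: upperZ.
by apply: upper_leq (upper_subrX A1 B1 IHd); lia.
Qed.

(** The polynomial identity is evaluated at [Q]; its error term dies because [Q ^+ h.*2 = 0]. *)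
Lemma msinh_martanh (k : fieldType) n h (Q : 'M[k]_n.+1) :
  [pchar k] =i pred0 -> (n < h.*2)%N -> upper 1 Q ->
  msinh h (martanh h Q) = mcosh h (martanh h Q) * Q.
Proof.
move=> char0 nh Q1; have [r] := sinh_cosh_artanh h char0.
move/(congr1 (horner_mx Q)); set A := \sum_(j < h) _ *: 'X^_.
have AQ : horner_mx Q A = martanh h Q.
  rewrite raddf_sum; apply: eq_bigr => j _ /=.
  by rewrite horner_mxZ rmorphXn /= horner_mx_X.
rewrite rmorphD. rewrite !rmorphM rmorphXn /= horner_mx_X.
rewrite (upper_eq0 nh (upper1X Q1)) mulr0 addr0 !raddf_sum /=.
under eq_bigr do rewrite horner_mxZ rmorphXn.
under [X in _ = X * _]eq_bigr do rewrite horner_mxZ rmorphXn.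
by rewrite /msinh /mcosh -AQ.
Qed.

Lemma upper_martanh (k : fieldType) n h (Q : 'M[k]_n.+1) :
  upper 1 Q -> upper 1 (martanh h Q).
Proof.
move=> Q1; apply: upper_sum => j; apply: upperZ.
by apply: upper_leq (upper1X Q1).
Qed.

(** * Matrices of factors of a word *)

(* The matrix whose (i, j) entry is the value of u at the letters of a from i
   (included) to j (excluded). *)
Definition factor_mx (k : fieldType) (a : seq nat) (u : seq nat -> k) :
    'M[k]_((size a).+1) :=
  \matrix_(i, j) if (i <= j)%N then u (take (j - i) (drop i a)) else 0.

(** The summation index of the matrix product is the position at which the factor from [i] to [j] is
    cut. *)
Lemma factor_mxM (k : fieldType) a (u v : seq nat -> k) :
  factor_mx a u * factor_mx a v = factor_mx a (conv u v).
Proof.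
apply/matrixP => i j; rewrite mxE [RHS]mxE.
under eq_bigr => h _ do rewrite !mxE.
have [ij|ji] := leqP i j; last first.
  apply: big1 => h _; case: leqP => ih; case: leqP => hj;
    rewrite ?mulr0 ?mul0r //; lia.
pose F h := u (take (h - i) (drop i a)) * v (take (j - h) (drop h a)).
have ja := ltn_ord j.
transitivity (\sum_(i <= h < j.+1) F h).
  rewrite (big_nat_widen _ _ _ _ _ ja) big_geq_mkord [RHS]big_mkcond /=.
  apply: eq_bigr => h _; rewrite ltnS andbC.
  by case: leqP => _; case: leqP => _; rewrite ?mulr0 ?mul0r.
rewrite -{1}[i : nat]add0n big_addn /conv cutsE big_map.
rewrite size_takel ?size_drop ?leq_sub2r // subSn //.
rewrite -[iota _ _]/(index_iota 0 (j - i).+1); apply: eq_big_nat => m /andP[_ mj].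
rewrite ltnS in mj; rewrite /F addnK -drop_drop (take_drop _ m).
have -> : (j - (m + i) + m = j - i)%N by lia.
by rewrite /= take_takel.
Qed.

Lemma eq_factor_mx (k : fieldType) a (u v : seq nat -> k) :
  (forall w, is_comp w -> (size w <= size a)%N -> u w = v w) ->
  is_comp a -> factor_mx a u = factor_mx a v.
Proof.
move=> uv pa; apply/matrixP => i j; rewrite !mxE; case: ifP => // ij; apply: uv.
  by apply/allP => x /mem_take/mem_drop/(allP pa).
by rewrite size_take_min size_drop geq_min leq_subr orbT.
Qed.

Lemma factor_mxD (k : fieldType) a (u v : seq nat -> k) :
  factor_mx a (fun w => u w + v w) = factor_mx a u + factor_mx a v.
Proof. by apply/matrixP => i j; rewrite !mxE; case: ifP; rewrite ?addr0. Qed.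

Lemma factor_mxZ (k : fieldType) a c (u : seq nat -> k) :
  factor_mx a (fun w => c * u w) = c *: factor_mx a u.
Proof. by apply/matrixP => i j; rewrite !mxE; case: ifP; rewrite ?mulr0. Qed.

Lemma factor_mx_sum (k : fieldType) a (I : finType) (u : I -> seq nat -> k) :
  factor_mx a (fun w => \sum_i u i w) = \sum_i factor_mx a (u i).
Proof.
apply/matrixP => i j; rewrite summxE !mxE; under [RHS]eq_bigr do rewrite mxE.
by case: ifP => // _; rewrite big1.
Qed.

Lemma factor_mx1 (k : fieldType) a :
  factor_mx a (fun w => (w == [::])%:R : k) = 1.
Proof.
apply/matrixP => i j; rewrite !mxE -val_eqE eqn_leq; case: leqP => //= ij.
have ja := ltn_ord j.
by rewrite -size_eq0 size_takel ?size_drop ?leq_sub2r // subn_eq0.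
Qed.

Lemma upper1_factor_mx (k : fieldType) a (u : seq nat -> k) :
  u [::] = 0 -> upper 1 (factor_mx a u).
Proof.
move=> u0 i j; rewrite mxE addn1 ltnS -subn_eq0 => /eqP->.
by rewrite take0 u0 if_same.
Qed.

Lemma factor_mx_full (k : fieldType) a (u : seq nat -> k) :
  factor_mx a u ord0 ord_max = u a.
Proof. by rewrite mxE /= subn0 drop0 take_size. Qed.

(* The coefficient of Q^m at w; the default 1 of [last] makes the empty word,
   which occurs for m = 0, satisfy the parity test. *)
Definition tanh_word (k : fieldType) m (w : seq nat) : k :=
  if odd (last 1%N w) && (nodd w == m) then (-1) ^+ (size w + m) else 0.

Lemma tanh_word0 (k : fieldType) w :
  tanh_word k 0 w = (w == [::])%:R.
Proof.
rewrite /tanh_word; case/lastP: w => [|w x] //=.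
rewrite last_rcons /nodd -cats1 count_cat /= addn0 -size_eq0 size_cat addn1.
by case: (odd x); rewrite ?addn1.
Qed.

Lemma tanh_word_odd (k : fieldType) m x w :
  odd x -> tanh_word k m.+1 (x :: w) = tanh_word k m w.
Proof.
move=> ox; rewrite /tanh_word /= ox add1n eqSS addSnnS !exprD !exprS !mulN1r.
by rewrite opprK; case: w => //=; rewrite ox.
Qed.

Lemma tanh_word_even (k : fieldType) m x w :
  ~~ odd x -> tanh_word k m.+1 (x :: w) = -1 * tanh_word k m.+1 w.
Proof.
move=> /negbTE ox; rewrite /tanh_word /= ox add0n.
by case: w => [|y w]; rewrite ?ox ?mulr0 //=; case: ifP; rewrite ?mulr0.
Qed.

(** A word ending in an odd letter decomposes uniquely into factors that each end at their only odd
    letter. An even letter contributes only a sign. *)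
Lemma tanh_wordS (k : fieldType) m w :
  tanh_word k m.+1 w = conv (tanh_word k 1) (tanh_word k m) w.
Proof.
elim: w => [|x w IHw]; first by rewrite conv_nil /tanh_word /= mul0r.
rewrite conv_cons [tanh_word k 1 [::]]/tanh_word /= mul0r add0r.
case ox: (odd x).
  rewrite conv_scalarl => [|y v]; rewrite !tanh_word_odd // tanh_word0 //.
  by rewrite mul1r.
have Qx : (fun v => tanh_word k 1 (x :: v)) =1 (fun v => -1 * tanh_word k 1 v).
  by move=> v; apply: tanh_word_even; rewrite ox.
by rewrite (eq_conv _ Qx) convZl -IHw tanh_word_even ?ox.
Qed.

(* The coefficients of 1 + Pe (b = false) and of Po (b = true). *)
Definition part_word (k : fieldType) (b : bool) (w : seq nat) : k :=
  ((size w <= 1)%N && (odd (sumn w) == b))%:R.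

(** This is [(1 + Pe) Q = Po]: an even first letter may be taken by [Pe] or left to [Q], and the two
    contributions cancel. *)
Lemma conv_part_tanh (k : fieldType) w :
  conv (part_word k false) (tanh_word k 1) w = part_word k true w.
Proof.
case: w => [|x w]; first by rewrite conv_nil /tanh_word /= mulr0.
rewrite conv_cons mul1r conv_scalarl; last by move=> y v; rewrite /part_word.
rewrite /part_word /= addn0; case ox: (odd x).
  rewrite mul0r addr0 tanh_word_odd // tanh_word0.
  by case: w => //=; rewrite addn0 ox.
rewrite tanh_word_even ?ox // -mulrDl addNr mul0r.
by case: w => //=; rewrite addn0 ox.
Qed.

Lemma factor_tanhX (k : fieldType) a m :
  factor_mx a (tanh_word k 1) ^+ m = factor_mx a (tanh_word k m).
Proof.
elim: m => [|m IHm].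
  by rewrite expr0 -(factor_mx1 k a); apply/matrixP => i j; rewrite !mxE tanh_word0.
rewrite exprS IHm factor_mxM.
by apply/matrixP => i j; rewrite !mxE tanh_wordS.
Qed.

(** * Series weighted by g *)

Definition even_part (k : fieldType) (phi : seq nat -> k) (w : seq nat) : k :=
  if all (fun n => ~~ odd n) w then phi w else 0.

(* The even (b = false) and odd (b = true) halves of the exponential series in
   the letters of odd degree. *)
Definition odd_exp (k : fieldType) (b : bool) (w : seq nat) : k :=
  if all odd w && (odd (size w) == b) then ((size w)`!%:R)^-1 else 0.

(** The coefficients of the [m]-th power of the sum of all odd letters. *)
Definition odd_word (k : fieldType) (m : nat) (w : seq nat) : k :=
  (all odd w && (size w == m))%:R.

Lemma odd_sumn w : odd (sumn w) = odd (nodd w).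
Proof. by elim: w => //= x w IHw; rewrite !oddD IHw; case: (odd x). Qed.

(** At most one cut separates even letters from odd ones, and the parity of the degree is that of
    the number of odd letters. In the induction, an even first letter is absorbed into [phi]. *)
Lemma conv_even_odd (k : fieldType) (phi : seq nat -> k) b w :
  conv (even_part phi) (odd_exp k b) w =
  if odd (sumn w) == b then even_odd_fun phi w else 0.
Proof.
elim: w phi => [|x w IHw] phi.
  by rewrite conv_nil /even_part /odd_exp /even_odd_fun /=; case: b; rewrite ?mulr0.
rewrite conv_cons /even_part /=; case ox: (odd x) => /=.
  rewrite [X in _ + X]big1 ?addr0 => [|p _]; last by rewrite mul0r.
  rewrite /odd_exp /even_odd_fun /evens /odds /nodd /= ox /=.
  case: (boolP (all odd w)) => [aw|/allPn[y yw oy]] /=.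
    rewrite (eq_in_filter (a2 := pred0)) ?filter_pred0 => [|y /(allP aw)->] //.
    move: (aw); rewrite all_count => /eqP wE.
    rewrite (all_filterP aw) eqxx /= oddD ox odd_sumn /nodd wE /=.
    by case: ifP; rewrite ?mulr0.
  (* With an even letter further on, a word of the form evens followed by odds would have to start
     with an even letter. *)
  rewrite mulr0; case: (_ =P b) => // _; case: eqP => // wE.
  have : y \in [seq n <- w | ~~ odd n] by rewrite mem_filter oy.
  case E: [seq n <- w | ~~ odd n] wE => [|z v] //= [xz _] _.
  have : z \in [seq n <- w | ~~ odd n] by rewrite E mem_head.
  by rewrite mem_filter -xz ox.
rewrite [odd_exp k b (x :: w)]/odd_exp /= ox mulr0 add0r.
rewrite -/(even_part (fun w => phi (x :: w))) IHw oddD ox /=.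
by rewrite /even_odd_fun /evens /odds /nodd /= ox /= eqseq_cons eqxx.
Qed.

Lemma conv_odd_word (k : fieldType) m w :
  conv (odd_word k 1) (odd_word k m) w = odd_word k m.+1 w.
Proof.
case: w => [|x w]; first by rewrite conv_nil /odd_word /= mul0r.
rewrite conv_cons {1}/odd_word /= mul0r add0r.
rewrite conv_scalarl => [|y v]; last by rewrite /odd_word /= !andbF.
by rewrite /odd_word /= !andbT eqSS -natrM mulnb andbA.
Qed.

(** Summed over [splits w], this is the coefficient at [w] of the series [f] after each letter [x_n]
    is replaced by the sum of [g c] times [c] over compositions [c] of [n]. *)
Definition weight (k : fieldType) (g f : seq nat -> k) (bs : seq (seq nat)) :
    k :=
  (\prod_(c <- bs) g c) * f (map sumn bs).

Lemma conv_weight (k : fieldType) (g f f' : seq nat -> k) bs :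
  conv (weight g f) (weight g f') bs = weight g (conv f f') bs.
Proof.
rewrite /weight /conv mulr_sumr.
elim: bs f => [|c bs IHbs] f /=; first by rewrite !big_seq1 /= !big_nil !mul1r.
rewrite !big_cons !big_map /= !big_nil mul1r mulrCA; congr (_ + _).
have := IHbs (fun w => f (sumn c :: w)).
move/(congr1 (fun x => g c * x)); rewrite !mulr_sumr => H.
under [RHS]eq_bigr do rewrite -mulrA.
rewrite -H; apply: eq_bigr => p _; rewrite big_cons /=.
by rewrite !mulrA.
Qed.

Definition weight_mx (k : fieldType) (a : seq nat) (g f : seq nat -> k) :=
  factor_mx a (split_sum (weight g f)).

Lemma weight_mxM (k : fieldType) a (g f f' : seq nat -> k) :
  is_comp a ->
  weight_mx a g f * weight_mx a g f' = weight_mx a g (conv f f').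
Proof.
move=> pa; rewrite /weight_mx factor_mxM; apply: eq_factor_mx => // w pw _.
by rewrite conv_split_sum //; apply: eq_bigr => bs _; apply: conv_weight.
Qed.

Lemma size_splits w bs : is_comp w -> bs \in splits w -> (size bs <= size w)%N.
Proof.
move=> pw; rewrite mem_splits // => /andP[/eqP<-].
elim: bs => //= c bs IHbs; rewrite inE negb_or size_cat => /andP[c0 /IHbs].
by case: c c0 => //= *; lia.
Qed.

Lemma sumn_splits w bs : bs \in splits w -> sumn (map sumn bs) = sumn w.
Proof.
case/mapP => b; rewrite mem_filter mem_compositions.
by case/andP=> /andP[_ /eqP bE] /andP[_ /eqP sb] ->; rewrite bE.
Qed.

Lemma eq_weight_mx (k : fieldType) a (g f f' : seq nat -> k) :
  is_comp a -> (forall w, (size w <= size a)%N -> f w = f' w) ->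
  weight_mx a g f = weight_mx a g f'.
Proof.
move=> pa ff'; apply: eq_factor_mx => // w pw wa; apply: eq_big_seq => bs.
move/(size_splits pw) => bsw; congr (_ * _); apply: ff'.
by rewrite size_map (leq_trans bsw).
Qed.

Lemma split_sum_nil (k : fieldType) (u : seq (seq nat) -> k) :
  split_sum u [::] = u [::].
Proof. by rewrite /split_sum /splits /= big_seq1. Qed.

Lemma split_sum_nilP (k : fieldType) (u : seq (seq nat) -> k) w :
  is_comp w -> (forall bs, bs != [::] -> u bs = 0) ->
  split_sum u w = (w == [::])%:R * u [::].
Proof.
move=> pw u0; case: eqP => [->|w0]; first by rewrite split_sum_nil mul1r.
rewrite mul0r /split_sum big_seq big1 // => bs.
rewrite mem_splits // => /andP[/eqP bsw _].
by apply: u0; apply: contra_notN w0 => /eqP bs0; rewrite -bsw bs0.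
Qed.

Lemma weight_mxX (k : fieldType) a (g : seq nat -> k) m :
  is_comp a ->
  weight_mx a g (odd_word k 1) ^+ m = weight_mx a g (odd_word k m).
Proof.
move=> pa; elim: m => [|m IHm].
  rewrite expr0 -(factor_mx1 k a); apply: eq_factor_mx => // w pw _.
  rewrite split_sum_nilP // => [|[|c bs] // _].
    by rewrite /weight big_nil /odd_word /= !mulr1.
  by rewrite /weight /odd_word /= andbF mulr0.
rewrite exprS IHm weight_mxM //; apply: eq_weight_mx => // w _.
exact: conv_odd_word.
Qed.

(** A factor of [a] splits into at most [size a] blocks, and only the exponent equal to the number
    of blocks contributes, so the truncated sum loses nothing. *)
Lemma weight_mx_odd_exp (k : fieldType) a (g : seq nat -> k) h (b : bool) :
  is_comp a -> (size a < h.*2)%N ->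
  weight_mx a g (odd_exp k b) =
  \sum_(j < h) ((j.*2 + b)`!%:R)^-1 *: weight_mx a g (odd_word k 1) ^+ (j.*2 + b).
Proof.
move=> pa ah.
under eq_bigr do rewrite weight_mxX // -factor_mxZ.
rewrite -factor_mx_sum; apply: eq_factor_mx => // w pw wa.
under eq_bigr do rewrite mulr_sumr.
rewrite exchange_big /=; apply: eq_big_seq => bs /(size_splits pw) bsw.
rewrite /weight; under [RHS]eq_bigr do rewrite mulrCA.
rewrite -mulr_sumr; congr (_ * _); rewrite /odd_exp /odd_word size_map.
case: (all odd _) => /=; last by rewrite big1 // => j _; rewrite mulr0.
have sh : (size bs < h.*2)%N by lia.
case: eqP => [sb|sb].
  have jh : ((size bs)./2 < h)%N by lia.
  rewrite (bigD1 (Ordinal jh)) //= big1 => [|j jE]; rewrite -sb.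
    by rewrite addnC odd_double_half eqxx mulr1 addr0.
  case: eqP => [sE|]; last by rewrite mulr0.
  by move: jE; rewrite -val_eqE /= sE sb addnC half_bit_double eqxx.
rewrite big1 // => j _; case: eqP => [sE|]; last by rewrite mulr0.
by case: sb; rewrite sE oddD odd_double oddb.
Qed.

(** * Extraction of coefficients *)

Lemma refines1 b : is_comp b -> refines b [:: sumn b].
Proof. by move=> pb; apply/refinesP => //; exists [:: b]; rewrite //= cats0. Qed.

Lemma block_prod1 (k : fieldType) (f : seq nat -> k) b :
  is_comp b -> block_prod f b [:: sumn b] = f b.
Proof.
move=> pb; rewrite /block_prod /= big_seq1.
by have := nparts_cat [::] pb; rewrite cats0 => ->; rewrite take_size.
Qed.

(* The monomial x_0^n, which occurs in M_c only for c = (n). *)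
Definition power0 (n : nat) : exponents := [fsfun x in [fset 0%N]%fset => n | 0%N].

Lemma monomial_power0 (k : fieldType) c n :
  (0 < n)%N -> monomial_qsym k c (power0 n) = (c == [:: n])%:R.
Proof.
move=> n0; rewrite /monomial_qsym.
have -> : finsupp (power0 n) = [fset 0%N]%fset.
  apply/fsetP => i; rewrite mem_finsupp fsfunE in_fset1.
  by case: (i =P 0%N); rewrite ?eqxx // -lt0n.
by rewrite enum_fsetE enum_fset1 /= fsfunE in_fset1 eqxx eq_sym.
Qed.

(** This is [E * exp(G) = 1 + P], read off from the coefficient of [x_0^|w|] in the expansion of
    [M_w]. *)
Lemma split_sum_basis (k : fieldType) (fE g : seq nat -> k) w :
  fE [::] = 1 ->
  (forall a, is_comp a ->
     monomial_qsym k a =1 coarser_sum g (even_odd_basis fE) a) ->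
  is_comp w -> split_sum (weight g (even_odd_fun fE)) w = (size w <= 1)%:R.
Proof.
move=> fE0 gP pw; case: (eqVneq w [::]) => [->|w0].
  rewrite split_sum_nil /weight big_nil /even_odd_fun /= fE0.
  by rewrite invr1 !mulr1.
have n0 : (0 < sumn w)%N.
  by case: w pw w0 => //= x w /andP[x0 _] _; rewrite addn_gt0 x0.
transitivity (monomial_qsym k w (power0 (sumn w))); last first.
  rewrite monomial_power0 //; congr (nat_of_bool _)%:R.
  case: w w0 {pw n0} => [|x [|y w]] //= _; last by rewrite eqseq_cons andbF.
  by rewrite addn0 eqxx.
rewrite gP // /coarser_sum /split_sum /splits big_map big_filter.
rewrite big_seq_cond [RHS]big_seq_cond; apply: eq_bigr => b /andP[].
rewrite mem_compositions => /andP[pb /eqP sb] /andP[_ /eqP bE].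
rewrite /weight bE; congr (_ * _); rewrite /even_odd_basis /coarser_sum.
(* In the expansion of [X_b], only the coarsest composition [(|b|)] contributes to this
   coefficient. *)
rewrite big_mkcond (bigD1_seq [:: sumn b]) ?compositions_uniq //=; last first.
  by rewrite mem_compositions /= sb n0 addn0 eqxx.
rewrite big1 => [|c /negbTE c0]; last first.
  by rewrite monomial_power0 // -sb c0 mulr0 if_same.
by rewrite refines1 // block_prod1 // monomial_power0 // sb eqxx mulr1 addr0.
Qed.

Lemma split_sum_odd_word (k : fieldType) (g : seq nat -> k) w :
  is_comp w -> odd (sumn w) -> split_sum (weight g (odd_word k 1)) w = g w.
Proof.
move=> pw ow; have ws : [:: w] \in splits w.
  by rewrite mem_splits //= cats0 eqxx inE; case: w ow {pw}.
rewrite /split_sum (bigD1_seq _ ws) ?splits_uniq //=.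
rewrite {1}/weight big_seq1 /odd_word /= ow mulr1 big_seq_cond big1 ?addr0 //.
move=> bs /andP[]; rewrite mem_splits // => /andP[/eqP bsw _] bs1.
rewrite /weight size_map.
case: bs bsw bs1 => [|c [|d bs]] /= bsw bs1; rewrite ?andbF ?mulr0 //.
by rewrite cats0 in bsw; rewrite bsw eqxx in bs1.
Qed.

Theorem theorem6p2 (k : fieldType) (char0 : [pchar k] =i pred0)
  (fE : seq nat -> k) (fE_char : nonsingular_shuffle_character fE)
  (g : seq nat -> k)
  (gP : forall a : seq nat, is_comp a ->
     monomial_qsym k a =1 coarser_sum g (even_odd_basis fE) a)
  (a : seq nat) (a_comp : is_comp a) (a_odd : odd (sumn a)) :
  g a = if odd (last 0%N a) then (-1) ^+ (size a).-1 / (nodd a)%:R else 0.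
Proof.
have fE0 := shuffle_char_nil fE_char.
(* Any [h] with [size a < h.*2] makes the truncated series exact. *)
set h := (size a).+1.
have ah : (size a < h.*2)%N by rewrite /h; lia.
pose G := weight_mx a g (odd_word k 1); pose Q := factor_mx a (tanh_word k 1).
pose E := weight_mx a g (even_part fE).
have G1 : upper 1 G.
  by apply: upper1_factor_mx; rewrite split_sum_nil /weight /odd_word mulr0.
have Q1 : upper 1 Q by apply: upper1_factor_mx.
have E1 : upper 1 (E - 1).
  rewrite -(factor_mx1 k a) -scaleN1r -factor_mxZ -factor_mxD.
  apply: upper1_factor_mx.
  by rewrite split_sum_nil /weight big_nil /even_part /= fE0 !mulr1 subrr.
(* Even letters preserve the parity of the degree, so each half of the exponential yields the words
   of [1 + P] of that parity. *)
have EO b : E * weight_mx a g (odd_exp k b) = factor_mx a (part_word k b).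
  rewrite weight_mxM //; apply: eq_factor_mx => // w pw _.
  rewrite /part_word andbC -mulnb natrM -(split_sum_basis fE0 gP pw) mulr_sumr.
  apply: eq_big_seq => bs /sumn_splits bsw.
  rewrite /weight conv_even_odd bsw; case: ifP => _; first by rewrite mul1r.
  by rewrite mul0r mulr0.
have GQ : msinh h G = mcosh h G * Q.
  have -> : msinh h G = weight_mx a g (odd_exp k true).
    rewrite (weight_mx_odd_exp _ _ _ ah) //.
    by apply: eq_bigr => j _; rewrite addn1.
  have -> : mcosh h G = weight_mx a g (odd_exp k false).
    rewrite (weight_mx_odd_exp _ _ _ ah) //.
    by apply: eq_bigr => j _; rewrite addn0.
  (* Multiplied by [E], the difference becomes [Po - (1 + Pe) Q], which is zero. *)
  apply/eqP; rewrite -subr_eq0; apply/eqP; apply: (unitriangular_lreg E1).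
  rewrite mulrBr mulrA !EO factor_mxM.
  apply/matrixP => i j; rewrite !mxE conv_part_tanh.
  by case: ifP; rewrite subrr.
have GE : G = martanh h Q.
  apply: (upper1_tanh_inj G1 (upper_martanh h Q1) Q1 GQ).
  by apply: msinh_martanh.
(* The corner entry is the coefficient at the whole word [a]. *)
have := congr1 (fun A : 'M_(_) => A ord0 ord_max) GE.
rewrite factor_mx_full split_sum_odd_word // => ->; rewrite summxE.
have oa := odd_sumn a; rewrite a_odd in oa.
have na : (nodd a <= size a)%N by apply: count_size.
(* Only the power of [Q] with exponent [nodd a] can be nonzero at [a]; this exponent is odd because
   [|a|] is. *)
have jh : ((nodd a)./2 < h)%N by rewrite /h; lia.
under eq_bigr do rewrite mxE factor_tanhX factor_mx_full.
rewrite (bigD1 (Ordinal jh)) //= big1 => [|j jE]; last first.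
  rewrite /tanh_word; case: eqP => [nE|_]; last by rewrite andbF mulr0.
  by move: jE; rewrite -val_eqE /= nE /= uphalf_double eqxx.
have -> : ((nodd a)./2.*2.+1 = nodd a)%N by lia.
rewrite addr0 /tanh_word eqxx andbT.
(* As [|a|] is odd, [a] is nonempty and the default of [last] is irrelevant. *)
have -> : odd (last 1%N a) = odd (last 0%N a) by case: (a) a_odd.
case: ifP => _; rewrite ?mulr0 // mulrC; congr (_ / _).
(* Since [nodd a] is odd, adding it to [size a] changes the sign just as subtracting one does. *)
have [n nE] : exists n, size a = n.+1.
  by case: (a) a_odd => // x s _; exists (size s).
by rewrite nE exprD -[X in _ * X]signr_odd -oa expr1 exprS mulrN1 mulN1r opprK.
Qed.
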